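(* Let $k \geq 2$ and let $a_1,a_2,\ldots,a_{k-1},a_k$ be nonnegative integers such that $a_1 < a_2 < \cdots < a_k$. Then there exists a positive integer $n$ with $n \leq a_k$ such that $$\mathcal{G}(a_1,a_2,\ldots,a_{k-1},a_k+n+i) = a_k+i \quad \text{for all integers } i \geq 0,$$ where $\mathcal{G}$ is the Sprague-Grundy function of the game Max-Welter.
   Context: Max-Welter is played with a finite number of coins on a semi-infinite strip of squares labeled $0,1,2,3,\ldots$ from its left end, each square containing at most one coin. A position with $k$ coins in squares $a_1<a_2<\cdots<a_k$ (nonnegative integers) is denoted $(a_1,a_2,\ldots,a_k)$. Two players move alternately; a move consists of taking the coin in the largest occupied square $a_k$ and moving it to any empty square on its left (jumping over other coins is legal). Only the rightmost coin of the current position may be moved; after a move the coins are re-indexed in increasing order. The player first unable to move loses. The Sprague-Grundy value $\mathcal{G}(p)$ of a position $p$ is defined recursively as the smallest nonnegative integer not equal to $\mathcal{G}(q)$ for any $q$ reachable from $p$ in one move (so a terminal position has value $0$). *)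

(* Defs.v *)
From mathcomp Require Import all_boot.

Set Implicit Arguments.
Unset Strict Implicit.
Unset Printing Implicit Defensive.

(* A position (a_1, ..., a_k) is the strictly increasing sequence
   [:: a_1; ...; a_k] of its occupied squares, i.e. some p with sorted ltn p. *)
Definition position := seq nat.

(* [take (size p).-1 p] is p without its largest coin.  The default value of
   [last] only matters for the position without coins, which has no option. *)
Definition options (p : position) : seq position :=
  [seq sort leq (j :: take (size p).-1 p) | j <- iota 0 (last 0 p) & j \notin p].

(* The numbers 0, ..., size s cannot all occur in s, so the search succeeds;
   the index found is the number itself. *)
Definition mex (s : seq nat) : nat :=
  find (fun n => n \notin s) (iota 0 (size s).+1).

Fixpoint grundy_rec (fuel : nat) (p : position) : nat :=
  if fuel is fuel'.+1 then mex [seq grundy_rec fuel' q | q <- options p] else 0.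

(* Each move decreases the sum of the coordinates, so this fuel suffices: see
   [grundyE]. *)
Definition grundy (p : position) : nat := grundy_rec (sumn p).+1 p.

Lemma mexP (s : seq nat) :
  mex s \notin s /\ (forall m, m < mex s -> m \in s).
Proof.
have hs : has (fun n => n \notin s) (iota 0 (size s).+1).
  apply/negPn/negP => /hasPn h.
  have /(uniq_leq_size (iota_uniq 0 (size s).+1)) :
    {subset iota 0 (size s).+1 <= s} by move=> n /h /negPn.
  by rewrite size_iota ltnn.
have hlt : mex s < (size s).+1.
  by move: hs; rewrite has_find size_iota.
split=> [|m hm].
  by have := nth_find 0 hs; rewrite -/(mex s) nth_iota.
have := before_find 0 hm; rewrite nth_iota ?(ltn_trans hm) //.
by rewrite add0n => /negbFE.
Qed.

Lemma mem_options (s : seq nat) (m : nat) (q : position) :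
  q \in options (rcons s m) <->
  exists2 j, (j < m) && (j \notin s) & q = sort leq (j :: s).
Proof.
rewrite /options last_rcons size_rcons /= -cats1 take_size_cat //.
split=> [/mapP[j] | [j /andP[jm js] ->]].
  rewrite mem_filter mem_iota mem_cat mem_seq1 negb_or => /andP[/andP[js _] jm].
  by move=> ->; exists j; rewrite // js andbT.
apply/mapP; exists j => //.
by rewrite mem_filter mem_iota mem_cat mem_seq1 negb_or js /= jm neq_ltn jm.
Qed.

Lemma sumn_options (p q : position) : q \in options p -> sumn q < sumn p.
Proof.
case/lastP: p => [|s m] // /mem_options[j /andP[jm _] ->].
by rewrite (perm_sumn (permEl (perm_sort leq _))) sumn_rcons /= addnC ltn_add2l.
Qed.

Lemma options_sorted (p q : position) :
  sorted ltn p -> q \in options p -> sorted ltn q.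
Proof.
case/lastP: p => [|s m] // hp /mem_options[j /andP[_ js] ->].
rewrite ltn_sorted_uniq_leq sort_uniq /= js (sort_sorted leq_total) andbT.
move: hp; rewrite -cats1 => /cat_sorted2[+ _].
by rewrite ltn_sorted_uniq_leq => /andP[].
Qed.

Lemma grundy_rec_fuel (f : nat) (p : position) :
  sumn p < f -> grundy_rec f p = grundy p.
Proof.
rewrite /grundy.
have gen f1 : forall f2 r, sumn r < f1 -> sumn r < f2 ->
    grundy_rec f1 r = grundy_rec f2 r.
  elim: f1 => [|f1 IH] [|f2] r //= h1 h2.
  congr mex; apply/eq_in_map => q /sumn_options hq.
  by apply: IH; apply: leq_trans hq _.
by move=> h; apply: gen.
Qed.

Lemma grundyE (p : position) : grundy p = mex [seq grundy q | q <- options p].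
Proof.
rewrite {1}/grundy /=; congr mex; apply/eq_in_map => q /sumn_options hq.
exact: grundy_rec_fuel.
Qed.

(* Main.v *)
(* Let m be the largest of a_1, ..., a_(k-1).  Moves of the coin on x > m to
   an empty square below m yield a set C of values that does not depend on x,
   and the other moves yield the values at m+1, ..., x-1.  Hence the values at
   m+1, m+2, ... enumerate the complement of C in increasing order.  Since a
   value never exceeds the largest coin, C lies below a_k, so that n is m+1
   minus the cardinality of C. *)
Require Import Defs.
From mathcomp Require Import all_boot zify.

Set Implicit Arguments.
Unset Strict Implicit.
Unset Printing Implicit Defensive.

Lemma mex_le_size (s : seq nat) : mex s <= size s.
Proof.
have [_ h] := mexP s.
rewrite -[leqLHS](size_iota 0) uniq_leq_size ?iota_uniq // => j.
by rewrite mem_iota => /h.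
Qed.

Lemma mex_unique (s : seq nat) (v : nat) :
  v \notin s -> (forall u, u < v -> u \in s) -> mex s = v.
Proof.
have [h1 h2] := mexP s => v1 v2.
case: (ltngtP (mex s) v) => // h; first by rewrite v2 in h1.
by rewrite h2 in v1.
Qed.

Lemma sorted_rconsE (T : Type) (r : rel T) (s : seq T) (x : T) :
  transitive r -> sorted r (rcons s x) = all (r^~ x) s && sorted r s.
Proof. by move=> r_tr; rewrite !sorted_pairwise // pairwise_rcons. Qed.

Lemma sorted_ltn_rcons_le (s : seq nat) (m : nat) :
  sorted ltn (rcons s m) -> all (leq^~ m) s.
Proof.
by rewrite (sorted_rconsE _ _ ltn_trans) => /andP[+ _]; apply: sub_all => x /ltnW.
Qed.

Lemma sort_rcons_max (s : seq nat) (m : nat) :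
  all (leq^~ m) s -> sort leq (rcons s m) = rcons (sort leq s) m.
Proof.
move=> sm; apply: (sorted_eq leq_trans anti_leq).
- exact: sort_sorted leq_total _.
- rewrite (sorted_rconsE _ _ leq_trans) sort_sorted ?andbT; last exact: leq_total.
  by rewrite all_sort.
- by rewrite perm_sort -!cats1 perm_cat2r perm_sym perm_sort.
Qed.

(** There are at most [last 0 p] options, and a mex is at most the length of its list. *)
Lemma grundy_le_last (p : position) : grundy p <= last 0 p.
Proof.
rewrite grundyE (leq_trans (mex_le_size _)) // !size_map size_filter.
by rewrite (leq_trans (count_size _ _)) ?size_iota.
Qed.

(** The recursion is greedy: [f t] is the least number outside [C] not yet taken by [f]. So [v]
    appears at its rank in the complement of [C], which is what the [count] computes. *)
Lemma mex_enum_complement (C : seq nat) (f : nat -> nat) (v : nat) :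
    (forall t, f t = mex (C ++ mkseq f t)) -> v \notin C ->
  f (count [predC C] (iota 0 v)) = v.
Proof.
move=> fE.
pose c w := count [predC C] (iota 0 w).
have step w : w \notin C ->
    (forall u, u < w -> u \in C ++ mkseq f (c w)) ->
    (forall t, t < c w -> f t < w) -> f (c w) = w.
  move=> wC h1 h2; rewrite fE; apply: mex_unique => //.
  rewrite mem_cat negb_or wC; apply/mapP=> -[t].
  by rewrite mem_iota => /h2 lt_w wE; rewrite -wE ltnn in lt_w.
(* Invariant for the induction on [w]: the first [c w] values of [f] all lie below [w] and, together
   with [C], cover everything below [w]. *)
suff main w : (forall u, u < w -> u \in C ++ mkseq f (c w)) /\
    (forall t, t < c w -> f t < w).
  by move=> vC; have [] := main v; apply: step.
elim: w => [|w [h1 h2]]; first by split.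
have cS : c w.+1 = c w + (w \notin C).
  by rewrite /c -addn1 iotaD count_cat /= addn0.
have [wC|wC] := boolP (w \in C).
  rewrite {}cS wC addn0; split=> [u|t /h2]; last exact: ltnW.
  by rewrite ltnS leq_eqVlt => /predU1P[->|/h1 //]; rewrite mem_cat wC.
rewrite {}cS wC addn1; split=> [u|t].
  rewrite ltnS leq_eqVlt /mkseq -(addn1 (c w)) iotaD map_cat catA mem_cat.
  case/predU1P=> [->|/h1->//].
  by rewrite /= add0n mem_seq1 step ?eqxx ?orbT.
by rewrite ltnS leq_eqVlt => /predU1P[->|/h2/ltnW//]; rewrite step.
Qed.

Lemma count_predC_iota (C : seq nat) (v : nat) :
  all (ltn^~ v) C -> count [predC C] (iota 0 v) = v - size (undup C).
Proof.
move=> /allP Cv.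
suff <- : count (mem C) (iota 0 v) = size (undup C).
  by rewrite -{2}(size_iota 0 v) -(count_predC (mem C)) addKn.
rewrite -size_filter; apply/perm_size/uniq_perm.
- by rewrite filter_uniq ?iota_uniq.
- exact: undup_uniq.
move=> x; rewrite mem_undup mem_filter mem_iota /= add0n.
by apply: andb_idr => /Cv.
Qed.

(** The set C described above, as a list that may contain repetitions; hence the later [undup]. *)
Definition inner_values (s : seq nat) (m : nat) : seq nat :=
  [seq grundy (sort leq (j :: rcons s m)) | j <- iota 0 m & j \notin rcons s m].

Lemma size_inner_values (s : seq nat) (m : nat) : size (inner_values s m) <= m.
Proof.
by rewrite size_map size_filter (leq_trans (count_size _ _)) ?size_iota.
Qed.

(** After such a move the coin on [m] is the largest one, so [grundy_le_last] applies. *)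
Lemma inner_values_le (s : seq nat) (m : nat) :
  all (leq^~ m) s -> all (leq^~ m) (inner_values s m).
Proof.
move=> sm; apply/allP=> _ /mapP[j + ->].
rewrite mem_filter mem_iota => /andP[_ /andP[_ /ltnW jm]].
rewrite -rcons_cons sort_rcons_max /= ?jm //.
by rewrite (leq_trans (grundy_le_last _)) ?last_rcons.
Qed.

Lemma grundy_rcons_mex (s : seq nat) (m t : nat) : sorted ltn (rcons s m) ->
  grundy (rcons (rcons s m) (m.+1 + t)) =
  mex (inner_values s m ++
       mkseq (fun i => grundy (rcons (rcons s m) (m.+1 + i))) t).
Proof.
move=> srt; rewrite grundyE /options last_rcons size_rcons -pred_Sn.
rewrite -[in take _ _](cats1 (rcons s m)) take_size_cat // -map_comp.
have sm : all (leq^~ m) (rcons s m).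
  by rewrite all_rcons leqnn (sorted_ltn_rcons_le srt).
rewrite (_ : filter _ (iota 0 _) =
  [seq j <- iota 0 m | j \notin rcons s m] ++ iota m.+1 t).
  rewrite map_cat; congr (mex (_ ++ _)).
  rewrite /mkseq -[in LHS](addn0 m.+1) iotaDl -map_comp.
  apply: eq_map => i /=; congr grundy.
  (* A coin landing beyond [m] stays the largest, so the option is again of the form
     [rcons (rcons s m) _]. *)
  rewrite -[RHS](sorted_sort leq_trans).
    by apply/perm_sortP; [exact: leq_total|exact: leq_trans|exact: anti_leq|
      rewrite perm_sym perm_rcons].
  rewrite (sorted_rconsE _ _ leq_trans) andbC (sub_sorted _ srt); last first.
    by move=> x y /ltnW.
  by apply: sub_all sm => x /leq_trans->//; rewrite addSn ltnW // ltnS leq_addr.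
(* The moving coin's own square is already excluded by the range of [j]. *)
transitivity [seq j <- iota 0 (m.+1 + t) | j \notin rcons s m].
  apply: eq_in_filter => j; rewrite mem_iota => /andP[_ jx].
  by rewrite mem_rcons inE negb_or neq_ltn jx.
(* The range is split at [m], which is occupied and drops out; all squares after it are empty. *)
rewrite addSnnS iotaD add0n filter_cat /= mem_rcons mem_head /=; congr (_ ++ _).
apply/all_filterP/allP => j; rewrite mem_iota => /andP[mj _] /=.
by apply/negP => /(allP sm); rewrite leqNgt mj.
Qed.

Theorem theorem5 (k : nat) (hk : 2 <= k) (a : (k.-1).-tuple nat) (ak : nat)
    (ha : sorted ltn (rcons a ak)) :
  exists n : nat, 0 < n /\ n <= ak /\
    forall i : nat, grundy (rcons a (ak + n + i)) = ak + i.
Proof.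
have: 0 < size a by rewrite size_tuple; lia.
move: ha; case/lastP: (tval a) => {a k hk} [|s m] // ha _.
move: ha; rewrite (sorted_rconsE _ _ ltn_trans) => /andP[].
rewrite all_rcons => /andP[/= m_lt _] srt.
set C := inner_values s m.
have Cm : size (undup C) <= m.
  exact: leq_trans (size_undup _) (size_inner_values _ _).
have C_lt i : all (ltn^~ (ak + i)) C.
  apply: sub_all (inner_values_le (sorted_ltn_rcons_le srt)) => x xm.
  exact: leq_ltn_trans xm (leq_trans m_lt (leq_addr _ _)).
(* The value [ak + i] has rank [ak + i - size (undup C)] in the complement of [C], and rank 0
   belongs to the square [m.+1]. The bounds on [n] come from [Cm] and [m < ak]. *)
exists (m.+1 - size (undup C)); split; first lia.
split; first lia.
move=> i; have aiC : ak + i \notin C.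
  by apply/negP => /(allP (C_lt i)) /=; rewrite ltnn.
have := mex_enum_complement (fun t => grundy_rcons_mex t srt) aiC.
rewrite count_predC_iota // -/C => <-.
congr (grundy (rcons _ _)); lia.
Qed.
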